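(* Let $m\ge 0$, $n\ge 2$ and $s$ be integers with $3\le s\le n-1$. Then $$\kappa(D_{m,n};K_s)=\left\lceil\frac{n-1}{s}\right\rceil+m .$$
   Context: All graphs are finite and simple. $K_s$ is the complete graph on $s$ vertices. Structure connectivity. For a set $\mathcal{F}$ of subgraphs of a connected graph $G$ (no disjointness is required), let $V(\mathcal{F})$ be the union of the vertex sets of its members and $G-\mathcal{F}=G-V(\mathcal{F})$. $\mathcal{F}$ is a subgraph cut of $G$ if $G-\mathcal{F}$ is disconnected or is a trivial graph (a single vertex). For a connected graph $H$, an $H$-structure cut is a subgraph cut each of whose members is isomorphic to $H$. $\kappa(G;H)$ is the minimum cardinality of an $H$-structure cut of $G$. DCell. Let $t_{0,n}=n$ and $t_{m,n}=t_{m-1,n}(t_{m-1,n}+1)$ for $m\ge 1$. Let $I_{0,n}=\{0,1,\dots,n-1\}$ and $I_{i,n}=\{0,1,\dots,t_{i-1,n}\}$ for $i\ge 1$. The $m$-dimensional DCell with $n$-port switches, $D_{m,n}$ ($m\ge 0$, $n\ge 2$), is the graph with vertex set $\{x_mx_{m-1}\cdots x_0 : x_i\in I_{i,n}\}$ defined recursively: $D_{0,n}$ is the complete graph on $n$ vertices; for $m\ge 1$, $D_{m,n}$ is obtained from $t_{m-1,n}+1$ disjoint copies $D^i_{m-1,n}$ ($i\in I_{m,n}$) of $D_{m-1,n}$, where the labels in the $i$-th copy are prefixed by $i$, by adding the following edges: for $u_m<v_m$ in $I_{m,n}$, the vertex $u=u_mu_{m-1}\cdots u_0$ is adjacent to $v=v_mv_{m-1}\cdots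 v_0$ if and only if $u_m=v_0+\sum_{j=1}^{m-1}v_j t_{j-1,n}$ and $v_m=u_0+\sum_{j=1}^{m-1}u_jt_{j-1,n}+1$. *)

(* Defs.v *)
From HB Require Import structures.
From mathcomp Require Import all_boot all_order all_algebra.
Set Implicit Arguments.
Unset Strict Implicit.
Unset Printing Implicit Defensive.

Record sgraph := SGraph {
  vertex :> finType;
  edge : rel vertex;
  edge_sym : symmetric edge;
  edge_irr : irreflexive edge }.

Definition isomorphic (G H : sgraph) : Prop :=
  exists f : G -> H, bijective f /\ forall x y, edge (f x) (f y) = edge x y.

(** The graph without vertices is neither disconnected nor trivial. *)
Definition disconnected (G : sgraph) : Prop :=
  exists x y : G, ~~ connect (@edge G) x y.

Definition trivial_graph (G : sgraph) : Prop := #|G| = 1.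

Lemma complete_edge_sym s : symmetric (fun x y : 'I_s => x != y).
Proof. by move=> x y; rewrite eq_sym. Qed.

Lemma complete_edge_irr s : irreflexive (fun x y : 'I_s => x != y).
Proof. by move=> x; rewrite eqxx. Qed.

Definition complete (s : nat) : sgraph :=
  SGraph (@complete_edge_sym s) (@complete_edge_irr s).

Section Induced.
Variables (G : sgraph) (A : {set G}).

Definition induced_edge : rel {x : G | x \in A} :=
  fun x y => edge (val x) (val y).

Lemma induced_edge_sym : symmetric induced_edge.
Proof. by move=> x y; rewrite /induced_edge edge_sym. Qed.

Lemma induced_edge_irr : irreflexive induced_edge.
Proof. by move=> x; rewrite /induced_edge edge_irr. Qed.

Definition induced : sgraph := SGraph induced_edge_sym induced_edge_irr.
End Induced.

(** A pair (W, E) of a set W of vertices of G and a set E of edges of G, each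
    edge being the set of its two ends, with all ends in W. *)
Definition is_subgraph (G : sgraph) (S : {set G} * {set {set G}}) : bool :=
  [forall e in S.2, exists x in S.1, exists y in S.1,
     edge x y && (e == [set x; y])].

Definition subgraph (G : sgraph) : finType :=
  {S : {set G} * {set {set G}} | is_subgraph S}.

Section SubgraphGraph.
Variables (G : sgraph) (S : subgraph G).

Definition sub_vertices : {set G} := (val S).1.

Definition sub_edge : rel {x : G | x \in sub_vertices} :=
  fun x y => [set val x; val y] \in (val S).2.

Lemma sub_edge_sym : symmetric sub_edge.
Proof. by move=> x y; rewrite /sub_edge setUC. Qed.

Lemma sub_edge_irr : irreflexive sub_edge.
Proof.
move=> x; apply/negP => xS.
have /forall_inP/(_ _ xS)/exists_inP[u _ /exists_inP[v _ /andP[uv /eqP xE]]] :=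
  valP S.
have := set21 u v; have := set22 u v.
rewrite -xE setUid !inE => /eqP ve /eqP ue.
by rewrite ue ve edge_irr in uv.
Qed.

Definition sub_graph : sgraph := SGraph sub_edge_sym sub_edge_irr.
End SubgraphGraph.

Section StructureConnectivity.
Variables (G H : sgraph).
Implicit Type F : {set subgraph G}.

Definition family_vertices F : {set G} := \bigcup_(S in F) sub_vertices S.

Definition remove F : sgraph := induced (~: family_vertices F).

Definition subgraph_cut F : Prop :=
  disconnected (remove F) \/ trivial_graph (remove F).

Definition structure_cut F : Prop :=
  subgraph_cut F /\ forall S, S \in F -> isomorphic (sub_graph S) H.

(** kappa(G; H) = k. This is a relation since a graph may have no H-structure
    cut; kappa(G; H) = k asserts in particular that one exists. *)
Definition is_kappa (k : nat) : Prop :=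
  (exists F, structure_cut F /\ #|F| = k) /\
  (forall F, structure_cut F -> k <= #|F|).
End StructureConnectivity.

Fixpoint dcell_t (m n : nat) : nat :=
  if m is m'.+1 then dcell_t m' n * (dcell_t m' n).+1 else n.

(** The word x_m x_(m-1) ... x_0 is the nested pair
    (x_m, (x_(m-1), ... (x_1, x_0))); [dcell_digit x j] is x_j for j <= m. *)
Fixpoint dcell_vertex (m n : nat) : finType :=
  if m is m'.+1 then ('I_(dcell_t m' n).+1 * dcell_vertex m' n)%type else 'I_n.

Fixpoint dcell_digit (m n : nat) : dcell_vertex m n -> nat -> nat :=
  match m return dcell_vertex m n -> nat -> nat with
  | 0 => fun x _ => nat_of_ord x
  | m'.+1 => fun x j => if j == m'.+1 then nat_of_ord x.1
                        else dcell_digit x.2 j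
  end.

Definition dcell_num (m n : nat) (x : dcell_vertex m n) : nat :=
  dcell_digit x 0 + \sum_(1 <= j < m.+1) dcell_digit x j * dcell_t j.-1 n.

Definition dcell_link (m n : nat) (u v : dcell_vertex m.+1 n) : bool :=
  [&& u.1 < v.1, nat_of_ord u.1 == dcell_num v.2
    & nat_of_ord v.1 == dcell_num u.2 + 1].

Fixpoint dcell_edge (m n : nat) : rel (dcell_vertex m n) :=
  match m return rel (dcell_vertex m n) with
  | 0 => fun u v => u != v
  | m'.+1 => fun u v => [|| (u.1 == v.1) && dcell_edge u.2 v.2,
                            @dcell_link m' n u v | @dcell_link m' n v u]
  end.

Lemma dcell_edge_sym m n : symmetric (@dcell_edge m n).
Proof.
elim: m => [|m IH] u v /=; first by rewrite eq_sym.
by rewrite eq_sym IH [_ || dcell_link v u]orbC.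
Qed.

Lemma dcell_edge_irr m n : irreflexive (@dcell_edge m n).
Proof.
elim: m => [|m IH] u /=; first by rewrite eqxx.
by rewrite IH andbF /dcell_link ltnn.
Qed.

Definition DCell (m n : nat) : sgraph :=
  SGraph (@dcell_edge_sym m n) (@dcell_edge_irr m n).

(* Main.v *)
Require Import Defs.
From HB Require Import structures.
From mathcomp Require Import all_boot all_order all_algebra.
From mathcomp Require Import zify.
Set Implicit Arguments.
Unset Strict Implicit.
Unset Printing Implicit Defensive.

(** Write c for the ceiling of (n - 1) / s, so that c - 1 sets of s vertices
    never cover n - 1 vertices while c of them can.

    The links between the copies that make up a DCell form a perfect matching
    ([edge_between], [link_unique]), hence lie in no triangle, and as s >= 3
    every K_s is confined to one copy at each level ([clique_in_copy]), in the
    end to one of the complete graphs D_(0,n). A vertex x has n - 1 neighbours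
    in its complete graph and m more, each in a different copy from x.

    At most c + m: c cliques avoiding x cover the n - 1 near neighbours, one
    clique for each of the m links covers the others
    ([exists_neighbourhood_cover]), and x is left isolated, or alone.

    At least c + m: by induction on m, fewer than c + m cliques leave a connected
    graph with at least two vertices ([dcell_resilience]). In dimension 0 too
    many vertices remain. In dimension m + 1 there are more copies than cliques,
    and the copies without deleted vertices are pairwise linked, so it is enough
    to reach one of them from any remaining vertex u. If the copy of u is hit by
    all the cliques, the partner of u is in an intact copy. Otherwise what remains
    of this copy is connected by induction, and a count shows that not all its
    links are blocked ([exists_link_out]): a clique in the copy blocks s of them,
    a clique elsewhere at most one.

    The upper bound only yields a cut of at most c + m cliques; the lower bound
    then makes the number exact. *)

(** * Cliques, families of sets and removal of vertices *)

Definition clique (G : sgraph) (S : {set G}) : Prop :=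
  {in S &, forall x y, x != y -> edge x y}.

(** Edges of G with both ends in A, as a relation on all of G: unlike the edges
    of [induced A] it allows comparing paths for different sets A. *)
Definition edge_in (G : sgraph) (A : {set G}) : rel G :=
  fun x y => [&& x \in A, y \in A & edge x y].

Lemma edge_in_sym (G : sgraph) (A : {set G}) : symmetric (edge_in A).
Proof. by move=> x y; rewrite /edge_in edge_sym andbCA. Qed.

Lemma connect_edge_in_sym (G : sgraph) (A : {set G}) :
  connect_sym (edge_in A).
Proof. exact/sym_connect_sym/edge_in_sym. Qed.

(** Transfers connectedness to the graph left after a deletion; the induction
    is on the path because membership in A has to be carried along it. *)
Lemma connect_induced (G : sgraph) (A : {set G}) (x y : induced A) :
  connect (edge_in A) (val x) (val y) -> connect (@edge (induced A)) x y.
Proof.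
case/connectP=> p; elim: p x => [|z p IHp] x /=.
  by move=> _ /val_inj ->; apply: connect0.
case/andP=> /and3P[_ zA xz] pP yE.
exact: connect_trans (@connect1 _ (@edge (induced A)) x (Sub z zA) xz)
                     (IHp (Sub z zA) pP yE).
Qed.

Lemma connect_homo (T U : finType) (e : rel T) (e' : rel U) (f : T -> U) :
    {homo f : x y / e x y >-> e' x y} ->
  {homo f : x y / connect e x y >-> connect e' x y}.
Proof.
move=> fh x y /connectP[p]; elim: p x => [|z p IHp] x /=.
  by move=> _ ->; apply: connect0.
case/andP=> /fh xz pP /(IHp _ pP); exact: connect_trans (connect1 xz).
Qed.

Lemma card_cover_le (T : finType) (F : {set {set T}}) s :
  (forall S, S \in F -> #|S| <= s) -> #|cover F| <= s * #|F|.
Proof.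
move=> Fs; apply: leq_trans (leq_card_cover F) _.
by rewrite mulnC -sum_nat_const leq_sum.
Qed.

Lemma exists_set_between (T : finType) (A C : {set T}) k :
    A \subset C -> #|A| <= k <= #|C| ->
  exists B : {set T}, [/\ A \subset B, B \subset C & #|B| = k].
Proof.
move=> AC /andP[]; elim: k => [|k IHk] Ak kC.
  by exists A; split=> //; lia.
have [Ak'|Ak'] := ltnP #|A| k.+1; last by exists A; split=> //; lia.
have [B [AB BC Bk]] := IHk Ak' (ltnW kC).
have /set0Pn[x] : C :\: B != set0.
  by rewrite -card_gt0 cardsD (setIidPr BC) Bk subn_gt0.
rewrite inE => /andP[xB xC]; exists (x |: B); split.
- exact: subset_trans AB (subsetUr _ _).
- by rewrite subUset sub1set xC.
- by rewrite cardsU1 xB Bk.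
Qed.

(** Sets of size exactly s are wanted, so the sets taken off U one at a time are
    allowed to spill over into T once fewer than s points of U are left. *)
Lemma exists_cover (T : finType) (U A : {set T}) s c :
    U \subset A -> s <= #|A| -> #|U| <= c * s ->
  exists F : {set {set T}},
    [/\ #|F| <= c, U \subset cover F
      & forall S, S \in F -> S \subset A /\ #|S| = s].
Proof.
move=> + sA; elim: c U => [|c IHc] U UA Uc.
  have -> : U = set0 by apply: cards0_eq; lia.
  by exists set0; rewrite cards0 sub0set; split=> // S; rewrite inE.
have [S [SA Ss US]] : exists S : {set T},
    [/\ S \subset A, #|S| = s & #|U :\: S| <= c * s].
  have [Us|Us] := leqP #|U| s.
    have [|S [US SA Ss]] := exists_set_between UA (k := s); first by rewrite Us.
    by exists S; split=> //; move: US; rewrite -setD_eq0 => /eqP ->; rewrite cards0.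
  have [|S [_ SU Ss]] := exists_set_between (sub0set U) (k := s).
    by rewrite cards0 (ltnW Us).
  exists S; split=> //; first exact: subset_trans SU UA.
  by rewrite cardsD (setIidPr SU) Ss; lia.
have [F [Fc UF FA]] := IHc (U :\: S) (subset_trans (subsetDl _ _) UA) US.
exists (S |: F); split.
- by rewrite cardsU1; lia.
- rewrite /cover bigcup_setU big_set1; apply/subsetP=> x xU.
  rewrite inE; case: (boolP (x \in S)) => //= xS.
  by apply: (subsetP UF); rewrite inE xS.
- by move=> S'; rewrite !inE => /predU1P[->|/FA].
Qed.

(** * Numbering of the vertices and links between copies *)

(** The numbering is a mixed-radix expansion with leading digit u.1; this step
    makes the induction for its bijectivity work as Euclidean division. *)
Lemma dcell_num_rec m n (u : DCell m.+1 n) :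
  dcell_num u = dcell_num (u.2 : DCell m n) + u.1 * dcell_t m n.
Proof.
rewrite /dcell_num big_nat_recr //= eqxx addnA; congr (_ + _ + _).
by apply: eq_big_nat => j /andP[_ jm]; rewrite ltn_eqF.
Qed.

Lemma dcell_num_lt m n (u : DCell m n) : dcell_num u < dcell_t m n.
Proof.
elim: m u => [|m IHm] u.
  by rewrite /dcell_num big_geq // addn0; apply: ltn_ord.
rewrite dcell_num_rec /= -addSn mulnS leq_add ?IHm //.
by rewrite leq_mul2r -ltnS ltn_ord orbT.
Qed.

Lemma dcell_num_inj m n : injective (@dcell_num m n).
Proof.
elim: m => [|m IHm] u v.
  by rewrite /dcell_num !big_geq // !addn0; apply: val_inj.
rewrite !dcell_num_rec => uv.
have ut := dcell_num_lt (u.2 : DCell m n).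
have vt := dcell_num_lt (v.2 : DCell m n).
have t0 : 0 < dcell_t m n by lia.
have /IHm e2 : dcell_num (u.2 : DCell m n) = dcell_num (v.2 : DCell m n).
  have := congr1 (modn^~ (dcell_t m n)) uv.
  by rewrite /= !(addnC (dcell_num _)) !modnMDl !modn_small.
have /val_inj e1 : u.1 = v.1 :> nat.
  by apply/eqP; rewrite -(eqn_pmul2r t0) -(eqn_add2l (dcell_num u.2)) {2}e2 uv.
by case: u v e1 e2 {uv ut vt} => [? ?] [? ?] /= -> ->.
Qed.

Lemma dcell_num_surj m n k : k < dcell_t m n ->
  exists u : DCell m n, dcell_num u = k.
Proof.
elim: m k => [|m IHm] k kt.
  by exists (Ordinal kt); rewrite /dcell_num big_geq // addn0.
have t0 : 0 < dcell_t m n by move: kt => /=; case: (dcell_t m n).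
have [y yE] := IHm _ (ltn_pmod k t0).
have qt : k %/ dcell_t m n < (dcell_t m n).+1 by rewrite ltn_divLR // mulnC.
by exists (Ordinal qt, y); rewrite dcell_num_rec yE /= addnC -divn_eq.
Qed.

Lemma card_dcell m n : #|DCell m n| = dcell_t m n.
Proof.
elim: m => [|m IHm]; first exact: card_ord.
by rewrite card_prod card_ord /= IHm mulnC.
Qed.

(** A crude bound, linear in m, is enough for every count below: the number of
    blocked links also grows linearly in m, with slope s < n. *)
Lemma dcell_t_ge m n : n * m.+1 <= dcell_t m n.
Proof. elim: m => [|m IHm] /=; nia. Qed.

Lemma bump_ltS h k t : k < t -> bump h k < t.+1.
Proof. by rewrite /bump; lia. Qed.

Lemma unbump_bump_lt h k t : h < t.+1 -> k < t -> unbump (bump h k) h < t.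
Proof. by rewrite /unbump /bump; lia. Qed.

Lemma unbump_lt h k t : h != k -> h < t.+1 -> k < t.+1 -> unbump h k < t.
Proof. by rewrite /unbump; lia. Qed.

Section Copies.
Variables m n : nat.
Local Notation D := (DCell m n).
Local Notation D' := (DCell m.+1 n).
Local Notation copy := 'I_(dcell_t m n).+1.
Implicit Types (i j : copy) (x y : D) (u v w : D').

Definition in_copy i x : D' := (i, x).

Lemma edge_in_copy i x y : edge (in_copy i x) (in_copy i y) = edge x y.
Proof. by rewrite /= eqxx /dcell_link ltnn /= orbF. Qed.

(** Copy i has one link to every other copy; listing these copies in increasing
    order, the link to copy j is attached to the vertex whose number is the
    rank of j in that list. *)
Lemma edge_between u v : u.1 != v.1 ->
  edge u v = (dcell_num (u.2 : D) == unbump u.1 v.1) &&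
             (dcell_num (v.2 : D) == unbump v.1 u.1).
Proof.
move=> uv; rewrite /= (negbTE uv) /dcell_link /unbump /=.
by move: uv; rewrite -val_eqE /=; lia.
Qed.

Lemma link_unique u v w :
  u.1 != v.1 -> u.1 != w.1 -> edge u v -> edge u w -> v = w.
Proof.
move=> uv uw; rewrite !edge_between // => /andP[/eqP u1 /eqP v1] /andP[/eqP u2 /eqP w1].
have e1 : v.1 = w.1.
  by apply: val_inj; move: uv uw u1 u2; rewrite -!val_eqE /unbump /=; lia.
have e2 : v.2 = w.2 by apply: (@dcell_num_inj m n); rewrite v1 w1 e1.
by case: v w e1 e2 {uv uw u1 u2 v1 w1} => [? ?] [? ?] /= -> ->.
Qed.

Lemma link_exists u : exists2 v, u.1 != v.1 & edge u v.
Proof.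
have ut := dcell_num_lt (u.2 : D).
have jt : bump u.1 (dcell_num (u.2 : D)) < (dcell_t m n).+1.
  exact: bump_ltS.
have rt : unbump (Ordinal jt) u.1 < dcell_t m n by exact: unbump_bump_lt.
have [y yE] := dcell_num_surj rt.
have ne : u.1 != (in_copy (Ordinal jt) y).1 by rewrite -val_eqE /= neq_bump.
exists (in_copy (Ordinal jt) y) => //.
by rewrite edge_between //= yE bumpK !eqxx.
Qed.

Lemma link_between i j : i != j ->
  exists x y, edge (in_copy i x) (in_copy j y).
Proof.
move=> ij; have ji : j != i by rewrite eq_sym.
have [x xE] := dcell_num_surj (unbump_lt ij (ltn_ord i) (ltn_ord j)).
have [y yE] := dcell_num_surj (unbump_lt ji (ltn_ord j) (ltn_ord i)).
by exists x, y; rewrite edge_between //= xE yE !eqxx.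
Qed.

(** The default value u is never taken: see [partnerP]. *)
Definition partner u : D' := odflt u [pick v : D' | (u.1 != v.1) && edge u v].

Lemma partnerP u : u.1 != (partner u).1 /\ edge u (partner u).
Proof.
rewrite /partner; case: pickP => [v /andP[]|/= no] //.
have [v uv euv] := link_exists u; have := no v.
by rewrite uv; rewrite /= in euv; rewrite euv.
Qed.

Lemma partner_copy_inj i : injective (fun x => (partner (in_copy i x)).1).
Proof.
move=> x y /= xy.
have [nx] := partnerP (in_copy i x); have [ny] := partnerP (in_copy i y).
rewrite !edge_between // => /andP[/eqP Ey _] /andP[/eqP Ex _].
by apply: (@dcell_num_inj m n); rewrite Ex Ey xy.
Qed.

(** The links form a matching, so a triangle cannot use one: its third vertex
    lies outside the copy of one of the ends of the link, and that end would
    have two links. *)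
Lemma clique_in_copy (S : {set D'}) : 2 < #|S| -> clique S ->
  {in S &, forall u v, u.1 = v.1}.
Proof.
move=> S3 cS u v uS vS; apply/eqP/negP => /negP uv.
have uv' : u != v by apply: contraNneq uv => ->.
have /card_gt0P[w] : 0 < #|S :\ u :\ v|.
  by move: S3; rewrite (cardsD1 u S) uS (cardsD1 v) !inE eq_sym uv' vS.
rewrite !inE => /and3P[wv wu wS].
have [wu1|wu1] := eqVneq u.1 w.1.
- case/eqP: wu; apply/esym/(@link_unique v u w).
  + by rewrite eq_sym.
  + by rewrite -wu1 eq_sym.
  + by apply: cS; rewrite // eq_sym.
  + by apply: cS; rewrite // eq_sym.
- case/eqP: wv; apply/esym/(@link_unique u v w) => //.
  + exact: cS.
  + by apply: cS; rewrite // eq_sym.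
Qed.
End Copies.

(** * Deleting few cliques leaves a DCell connected *)

Definition clique_family (G : sgraph) s (F : {set {set G}}) : Prop :=
  forall S, S \in F -> #|S| = s /\ clique S.

(** Deleting a family F of cliques from D_(m+1,n) deletes the cliques
    [slices i] from copy i, which is what the induction on m sees. *)
Section Slices.
Variables (m n s : nat) (F : {set {set DCell m.+1 n}}).
Hypotheses (s3 : 2 < s) (Fcl : clique_family s F).
Local Notation D := (DCell m n).
Local Notation D' := (DCell m.+1 n).
Local Notation copy := 'I_(dcell_t m n).+1.
Implicit Types (i j : copy) (x y : D) (S : {set D'}).

Definition slice i S : {set D} := [set x | in_copy i x \in S].

(** Slices are taken of these sets only: a set away from copy i would contribute
    the empty slice, which is no clique of size s. *)
Definition touching i : {set {set D'}} := [set S in F | slice i S != set0].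

Definition slices i : {set {set D}} := slice i @: touching i.

Definition faulty : {set copy} := [set u.1 | u in cover F].

Lemma same_copy S : S \in F -> {in S &, forall u v : D', u.1 = v.1}.
Proof. by case/Fcl=> Ss; apply: clique_in_copy; rewrite Ss. Qed.

Lemma mem_cover_slices i x : (x \in cover (slices i)) = (in_copy i x \in cover F).
Proof.
apply/bigcupP/bigcupP => [[_ /imsetP[S + ->]]|[S SF xS]].
  by rewrite !inE => /andP[SF _] xS; exists S.
exists (slice i S); last by rewrite inE.
by apply: imset_f; rewrite inE SF; apply/set0Pn; exists x; rewrite inE.
Qed.

Lemma slices_clique i : clique_family s (slices i).
Proof.
move=> _ /imsetP[S + ->]; rewrite inE => /andP[SF /set0Pn[z]]; rewrite inE => zS.
have [Ss cS] := Fcl SF; split; last first.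
  move=> x y; rewrite !inE => xS yS xy; rewrite -(edge_in_copy i).
  by apply: cS => //; apply: contraNneq xy => -[->].
rewrite -Ss -(card_imset (slice i S) (f := in_copy i)); last by move=> x y [].
apply: eq_card => u; apply/imsetP/idP => [[x] | uS]; first by rewrite inE => xS ->.
have := same_copy SF uS zS; case: u uS => [j x] /= uS ji.
by exists x; rewrite ?inE /in_copy -?ji.
Qed.

Lemma card_slices i : #|slices i| <= #|touching i|.
Proof. exact: leq_imset_card. Qed.

(** Each clique lies in one copy, so those away from copy i account for at most
    one faulty copy each. *)
Lemma card_faulty i : #|faulty :\ i| + #|touching i| <= #|F|.
Proof.
(* [idx S] is the copy containing S; the default is taken for no S in F. *)
pose idx S := odflt ord0 [pick j : copy | slice j S != set0].
have tF : touching i \subset F by apply/subsetP=> S; rewrite inE => /andP[].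
suff : #|faulty :\ i| <= #|F :\: touching i|.
  by have := subset_leq_card tF; rewrite (cardsD F) (setIidPr tF); lia.
apply: leq_trans (leq_imset_card idx _); apply/subset_leq_card/subsetP => j.
rewrite !inE => /andP[ji /imsetP[u /bigcupP[S SF uS] uE]].
apply/imsetP; exists S.
  rewrite !inE SF andbT /=; apply/set0Pn => -[x]; rewrite inE => xS.
  by rewrite uE (same_copy SF uS xS) eqxx in ji.
rewrite /idx; case: pickP => [j' /set0Pn[x]|no] /=.
  by rewrite inE => xS; rewrite uE (same_copy SF uS xS).
have /set0Pn := no u.1; case; exists (u.2 : D); rewrite inE.
by case: (u) uS.
Qed.

Lemma touching_not_faulty i : i \notin faulty -> touching i = set0.
Proof.
move=> iB; apply/setP=> S; rewrite !inE; apply: contraNF iB => /andP[SF /set0Pn[x]].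
rewrite inE => xS; apply/imsetP; exists (in_copy i x) => //.
by apply/bigcupP; exists S.
Qed.

Lemma not_faulty_alive (u : D') : u.1 \notin faulty -> u \in ~: cover F.
Proof. by rewrite inE; apply: contraNN => uF; apply/imsetP; exists u. Qed.

Lemma connect_in_copy i x y :
    connect (edge_in (~: cover (slices i))) x y ->
  connect (edge_in (~: cover F)) (in_copy i x) (in_copy i y).
Proof.
apply: (connect_homo (f := in_copy i)) => {}x {}y.
by rewrite /edge_in !inE !mem_cover_slices edge_in_copy.
Qed.

(** The vertices of copy i to be avoided are the deleted ones, at most s for each
    clique touching the copy, and those with partner in another faulty copy, at
    most one for each such copy because different vertices of copy i have partners
    in different copies. *)
Lemma exists_link_out i : s * #|touching i| + #|faulty :\ i| < dcell_t m n ->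
  exists2 x, in_copy i x \in ~: cover F & (partner (in_copy i x)).1 \notin faulty.
Proof.
move=> lt; pose p x := (partner (in_copy i x)).1.
pose bad := cover (slices i) :|: (p @^-1: (faulty :\ i)).
have badt : #|bad| < dcell_t m n.
  apply: leq_ltn_trans lt; apply: leq_trans (leq_card_setU _ _) (leq_add _ _).
    apply: leq_trans (card_cover_le (s := s) _) _.
      by move=> S /slices_clique[->].
    by rewrite leq_mul2l card_slices orbT.
  rewrite -(card_imset _ (@partner_copy_inj m n i)).
  by apply/subset_leq_card/subsetP => _ /imsetP[x + ->]; rewrite inE.
have /set0Pn[x] : ~: bad != set0.
  by rewrite -card_gt0 cardsCs setCK card_dcell subn_gt0.
rewrite !inE negb_or mem_cover_slices => /andP[xF xB]; exists x; first by rewrite inE.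
by move: xB; have [ne _] := partnerP (in_copy i x); rewrite /p eq_sym ne.
Qed.
End Slices.

(** Here c is one less than the ceiling of (n - 1) / s, so s * c < n - 1 says that
    c cliques leave two vertices of the complete graph on n vertices. A copy hit
    by f <= c + m of at most c + m + 1 cliques has at most
    s * f + (c + m + 1 - f) <= s * (c + m) + 1 < n * (m + 1) blocked links,
    which is fewer than its number of links; a copy hit by more is hit by all. *)
Lemma dcell_resilience m n s c (F : {set {set DCell m n}}) :
    2 < s < n -> s * c < n.-1 -> clique_family s F -> #|F| <= c + m ->
  {in ~: cover F &, forall x y, connect (edge_in (~: cover F)) x y} /\
  1 < #|~: cover F|.
Proof.
move=> /andP[s3 sn] sc; elim: m F => [|m IHm] F Fcl Fc.
  split=> [x y xA yA|].
    have [->|xy] := eqVneq x y; first exact: connect0.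
    by apply: connect1; rewrite /edge_in xA yA.
  have Fs : #|cover F| <= s * c.
    apply: leq_trans (card_cover_le (s := s) _) _; first by move=> S /Fcl[->].
    by rewrite leq_mul2l -(addn0 c) Fc orbT.
  rewrite cardsCs setCK card_dcell ltn_subRL addn1 /=.
  by rewrite -ltn_predRL (leq_ltn_trans Fs sc).
set A := ~: cover F; have tn := dcell_t_ge m n.
have conn_copy i x y : #|touching F i| <= c + m ->
    in_copy i x \in A -> in_copy i y \in A ->
    connect (edge_in A) (in_copy i x) (in_copy i y).
  move=> fi xA yA; apply: connect_in_copy.
  have [|conn _] := IHm (slices F i) (slices_clique s3 Fcl (i := i)).
    exact: leq_trans (card_slices _ _) fi.
  by apply: conn; rewrite inE mem_cover_slices // -in_setC.
have conn_intact (u v : DCell m.+1 n) :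
    u.1 \notin faulty F -> v.1 \notin faulty F -> connect (edge_in A) u v.
  have conn1 j x y : j \notin faulty F ->
      connect (edge_in A) (in_copy j x) (in_copy j y).
    move=> jB; apply: conn_copy; rewrite ?touching_not_faulty ?cards0 //;
      exact: not_faulty_alive.
  case: u v => [i x] [j y] /= iB jB.
  have [<-|ij] := eqVneq i j; first exact: conn1.
  have [x' [y' e]] := link_between ij.
  apply: connect_trans (conn1 i x x' iB) _.
  apply: connect_trans (connect1 _) (conn1 j y' y jB).
  by rewrite /edge_in e !not_faulty_alive.
have reach (u : DCell m.+1 n) : u \in A ->
    exists2 v : DCell m.+1 n, v.1 \notin faulty F & connect (edge_in A) u v.
  move=> uA; have leave (v : DCell m.+1 n) : v \in A ->
      (partner v).1 \notin faulty F -> connect (edge_in A) v (partner v).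
    move=> vA pv; have [_ e] := partnerP v.
    by apply: connect1; rewrite /edge_in vA e not_faulty_alive.
  have := card_faulty s3 Fcl u.1.
  have [few|many] := leqP #|touching F u.1| (c + m) => fF.
    have [|x xA xB] := @exists_link_out _ _ _ _ s3 Fcl u.1.
      by nia.
    exists (partner (in_copy u.1 x)) => //.
    apply: connect_trans (leave _ xA xB).
    have uE : u = in_copy u.1 (u.2 : DCell m n) by case: (u).
    by rewrite {1}uE; apply: conn_copy => //; rewrite -uE.
  (* All the cliques touch the copy of u, so no other copy is faulty. *)
  have pB : (partner u).1 \notin faulty F.
    have /setP/(_ (partner u).1) : faulty F :\ u.1 = set0 by apply: cards0_eq; lia.
    by have [ne _] := partnerP u; rewrite !inE eq_sym ne => /= ->.
  by exists (partner u) => //; apply: leave.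
split=> [u v uA vA|].
  have [u' u'B uu'] := reach u uA; have [v' v'B vv'] := reach v vA.
  apply: connect_trans uu' (connect_trans (conn_intact u' v' u'B v'B) _).
  by rewrite connect_edge_in_sym.
(* An intact copy already has two vertices. *)
have [j jB] : exists j, j \notin faulty F.
  apply/existsP; rewrite -negb_forall; apply/negP => /forallP allB.
  have := card_faulty s3 Fcl ord0.
  have -> : #|faulty F :\ ord0| = dcell_t m n.
    have -> : faulty F = setT by apply/setP=> j; rewrite allB inE.
    by rewrite setTD cardsC1 card_ord.
  by nia.
have inj : injective (@in_copy m n j) by move=> x y [].
have : in_copy j @: [set: DCell m n] \subset A.
  by apply/subsetP=> _ /imsetP[x _ ->]; apply: not_faulty_alive.
move=> /subset_leq_card; rewrite card_imset // cardsT card_dcell.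
by apply: leq_trans; nia.
Qed.

(** * Isolating a vertex *)

Lemma clique_in_copy_image m n (i : 'I_(dcell_t m n).+1) s (S : {set DCell m n}) :
  #|S| = s /\ clique S ->
  #|in_copy i @: S| = s /\ clique (in_copy i @: S).
Proof.
case=> Ss cS; split; first by rewrite card_imset // => x y [].
move=> _ _ /imsetP[x xS ->] /imsetP[y yS ->] xy; rewrite edge_in_copy.
by apply: cS => //; apply: contraNneq xy => ->.
Qed.

Lemma exists_clique_at m n s (x : DCell m n) : 0 < s <= n ->
  exists2 S : {set DCell m n}, x \in S & #|S| = s /\ clique S.
Proof.
move=> sn; elim: m x => [|m IHm] x.
  have [|S [xS _ Ss]] := @exists_set_between _ [set x] setT s (subsetT _).
    by rewrite cards1 cardsT card_dcell.
  by exists S; rewrite -?sub1set //; split=> // y z _ _.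
case: x => i x; have [S xS Sc] := IHm x.
exists (in_copy i @: S); first exact: imset_f.
exact: clique_in_copy_image.
Qed.

(** The n - 1 neighbours of x in its own complete graph are covered by c cliques,
    and each of its m links by a clique in the copy at the other end. *)
Lemma exists_neighbourhood_cover m n s c (x : DCell m n) :
    0 < s < n -> n.-1 <= c * s ->
  exists F : {set {set DCell m n}},
    [/\ clique_family s F, #|F| <= c + m, x \notin cover F
      & forall y, edge x y -> y \in cover F].
Proof.
move=> sn nc; elim: m x => [|m IHm] x.
  have cx : #|[set~ x]| = n.-1 by rewrite cardsC1 card_dcell.
  have [||F [Fc xF FS]] := @exists_cover _ [set~ x] [set~ x] s c (subxx _).
  - by rewrite cx; lia.
  - by rewrite cx.
  exists F; split.
  - by move=> S /FS[_ ->]; split=> // y z _ _.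
  - by rewrite addn0.
  - by apply/bigcupP => -[S /FS[/subsetP Sx _] /Sx]; rewrite !inE eqxx.
  - by move=> y xy; apply: (subsetP xF); rewrite !inE eq_sym.
case: x => i x; have [F [Fcl Fc xF Fx]] := IHm x.
have [ne xp] := partnerP (in_copy i x); set p := partner _ in ne xp.
have [|S pS Scl] := @exists_clique_at m n s (p.2 : DCell m n).
  by case/andP: sn => -> /ltnW.
pose lift j (S : {set DCell m n}) := in_copy j @: S.
exists (lift p.1 S |: lift i @: F); rewrite /cover bigcup_setU big_set1 -/(cover _).
have in_lift y : (in_copy i y \in cover (lift i @: F)) = (y \in cover F).
  apply/bigcupP/bigcupP => [[_ /imsetP[S' S'F ->] /imsetP[z zS [->]]]|[S' S'F yS']].
    by exists S'.
  by exists (lift i S'); apply: imset_f.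
split.
- move=> S'; rewrite !inE => /predU1P[->|/imsetP[{}S' /Fcl S'cl ->]];
    exact: clique_in_copy_image.
- by rewrite addnS cardsU1 (leq_add (leq_b1 _)) // (leq_trans (leq_imset_card _ _)).
- rewrite !inE in_lift negb_or xF andbT.
  by apply: contraNN ne => /imsetP[z _ [->]].
- move=> y xy; rewrite !inE; have [iy|iy] := eqVneq i y.1.
    move: xy; have -> : y = in_copy i (y.2 : DCell m n) by rewrite iy; case: (y).
    by rewrite in_lift edge_in_copy => /Fx ->; rewrite orbT.
  have -> : y = p by apply: (@link_unique _ _ (in_copy i x)).
  by apply/orP; left; apply/imsetP; exists (p.2 : DCell m n) => //; case: (p).
Qed.

Lemma isolated_not_connect (G : sgraph) (x y : G) :
  (forall z, ~~ edge x z) -> x != y -> ~~ connect (@edge G) x y.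
Proof.
move=> iso xy; apply/negP => /connectP[[|z p] /= pP yE].
  by rewrite yE eqxx in xy.
by case/andP: pP => xz _; rewrite (negbTE (iso z)) in xz.
Qed.

(** * Complete subgraphs as sets of vertices *)

Definition induced_edges (G : sgraph) (S : {set G}) : {set {set G}} :=
  [set [set p.1; p.2] | p in
     [set p : G * G | [&& p.1 \in S, p.2 \in S & edge p.1 p.2]]].

Lemma induced_edges_subgraph (G : sgraph) (S : {set G}) :
  is_subgraph (S, induced_edges S).
Proof.
apply/forall_inP => _ /imsetP[[x y] + ->]; rewrite inE /= => /and3P[xS yS xy].
by apply/exists_inP; exists x => //; apply/exists_inP; exists y; rewrite ?xy /=.
Qed.

Definition induced_subgraph (G : sgraph) (S : {set G}) : subgraph G :=
  Sub (S, induced_edges S) (induced_edges_subgraph S).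

Lemma clique_isomorphic (G : sgraph) s (S : {set G}) :
  #|S| = s -> clique S ->
  isomorphic (sub_graph (induced_subgraph S)) (complete s).
Proof.
move=> Ss cS; pose T : finType := {x : G | x \in S}.
have Ts : #|T| = s by rewrite card_sig -Ss; apply: eq_card => x; rewrite !inE.
exists (fun x : T => cast_ord Ts (enum_rank x)); split.
  exists (fun i => enum_val (cast_ord (esym Ts) i)) => [x|i].
    by rewrite cast_ordK enum_rankK.
  by rewrite enum_valK cast_ordKV.
move=> x y; rewrite /= (inj_eq (@cast_ord_inj _ _ Ts)) (inj_eq enum_rank_inj).
rewrite /sub_edge /=; apply/idP/imsetP => [xy|[[u v]]].
  exists (val x, val y); rewrite // inE (valP x) (valP y) /=.
  by apply: cS; rewrite ?(valP x) ?(valP y) // (inj_eq val_inj).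
rewrite inE /= => /and3P[_ _ uv] e; apply: contraTneq uv => xy.
have := set21 u v; have := set22 u v; rewrite -e xy setUid !inE => /eqP -> /eqP ->.
by rewrite edge_irr.
Qed.

(** Only the vertex set of a copy of K_s matters for deletion, and it is a clique
    of G because the edges of a subgraph are edges of G. *)
Lemma isomorphic_clique (G : sgraph) s (S : subgraph G) :
  isomorphic (sub_graph S) (complete s) ->
  #|sub_vertices S| = s /\ clique (sub_vertices S).
Proof.
case=> f [fbij fE]; split.
  rewrite -[RHS]card_ord -(bij_eq_card fbij) /= card_sig.
  by apply: eq_card => x; rewrite !inE.
move=> x y xS yS xy; pose x' : sub_graph S := Sub x xS; pose y' : sub_graph S := Sub y yS.
have : edge x' y' by rewrite -fE /= (bij_eq fbij) -val_eqE.
rewrite /= /sub_edge /= => xyS.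
have /forall_inP/(_ _ xyS)/exists_inP[u _ /exists_inP[v _ /andP[uv /eqP e]]] := valP S.
move: xy; have := set21 x y; have := set22 x y; rewrite e !inE.
by move=> /orP[]/eqP-> /orP[]/eqP->; rewrite ?eqxx ?uv ?(edge_sym v) ?uv.
Qed.

Lemma ceil_div_bounds (a s c : nat) : 0 < s -> 0 < a ->
    c = `|Num.ceil (a%:R / s%:R : rat)%R|%N ->
  [/\ 0 < c, s * c.-1 < a & a <= c * s].
Proof.
move=> s0 a0; set q := (a%:R / s%:R : rat)%R => cE.
have s0' : (0 < s%:R :> rat)%R by rewrite Num.Theory.ltr0n.
have q0 : (0 < Num.ceil q)%R.
  by rewrite Num.Theory.ceil_gt0 Num.Theory.divr_gt0 // Num.Theory.ltr0n.
have c0 : 0 < c by rewrite cE absz_gt0 Order.POrderTheory.gt_eqF.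
have qE : Num.ceil q = Posz c.-1.+1 by rewrite prednK // cE gtz0_abs.
have /andP[] := Num.Theory.ceil_itv q.
rewrite qE -addn1 PoszD GRing.addrK -(PoszD c.-1 1) addn1 prednK // -!pmulrn.
rewrite Num.Theory.ltr_pdivlMr // Num.Theory.ler_pdivrMr //.
by rewrite -!GRing.natrM Num.Theory.ltr_nat Num.Theory.ler_nat mulnC.
Qed.

Theorem theorem3p8 (m n s : nat) (hn : 2 <= n) (hs : 3 <= s) (hsn : s <= n - 1) :
  is_kappa (DCell m n) (complete s)
    (`|Num.ceil ((n - 1)%:R / s%:R : rat)%R|%N + m).
Proof.
set c := `|_|%N.
have [||c0 sc nc] := @ceil_div_bounds (n - 1) s c _ _ erefl; [lia|lia|].
have s0 : 2 < s < n by lia.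
have lower (F : {set subgraph (DCell m n)}) :
    structure_cut (complete s) F -> c + m <= #|F|.
  move=> [cutF isoF]; rewrite leqNgt; apply/negP => Fc.
  pose C := [set sub_vertices S | S in F].
  have coverC : family_vertices F = cover C.
    apply/setP=> x; apply/bigcupP/bigcupP => [[S SF xS]|[_ /imsetP[S SF ->] xS]].
      by exists (sub_vertices S); first exact: imset_f.
    by exists S.
  have Ccl : clique_family s C.
    by move=> _ /imsetP[S SF ->]; apply/isomorphic_clique/isoF.
  have [||conn two] := @dcell_resilience m n s c.-1 C s0 _ Ccl.
  - by rewrite -(subn1 n).
  - by apply: leq_trans (leq_imset_card _ _) _; lia.
  move: cutF; rewrite /subgraph_cut /remove coverC => -[[x [y /negP]]|].
    case; apply: connect_induced; apply: conn; exact: valP.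
  rewrite /trivial_graph /= card_sig => one; move: two.
  by rewrite (_ : #|_| = 1) // -one; apply: eq_card => x; rewrite !inE.
split=> //; have x : DCell m n.
  apply: (enum_val (Ordinal (_ : 0 < #|DCell m n|))).
  by rewrite card_dcell; have := dcell_t_ge m n; nia.
have [||C [Ccl Cc xC Cx]] := @exists_neighbourhood_cover m n s c x; [lia|lia|].
pose F := [set induced_subgraph S | S in C].
have vertF : family_vertices F = cover C.
  apply/setP=> y; apply/bigcupP/bigcupP => [[_ /imsetP[S SC ->] yS]|[S SC yS]].
    by exists S.
  by exists (induced_subgraph S); first exact: imset_f.
have cutF : structure_cut (complete s) F.
  split; last by move=> _ /imsetP[S /Ccl[Ss cS] ->]; apply: clique_isomorphic.
  rewrite /subgraph_cut /remove vertF.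
  have xA : x \in ~: cover C by rewrite inE.
  pose x' : induced (~: cover C) := Sub x xA.
  case: (pickP (fun y : induced (~: cover C) => x' != y)) => [y xy|only_x].
    left; exists x', y; apply: isolated_not_connect xy => z.
    by apply: contraL (valP z) => /Cx; rewrite inE negbK.
  right; apply: (@eq_card1 _ x') => y.
  by rewrite !inE eq_sym; apply/esym/negbFE/only_x.
exists F; split=> //; apply/eqP; rewrite eqn_leq (lower _ cutF) andbT.
exact: leq_trans (leq_imset_card _ _) Cc.
Qed.
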